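(* Let $M\geq2$. Every real $M\times N$ unit norm frame $F$ has worst-case coherence $$\mu_F\geq\cos\bigg[\pi\Big(\tfrac{M-1}{N\pi^{1/2}}\,\tfrac{\Gamma(\frac{M-1}{2})}{\Gamma(\frac{M}{2})}\Big)^{\frac{1}{M-1}}\bigg].$$ Furthermore, if $a>0$ is a constant and $N=N(M)$ satisfies $N=\Theta(a^M)$, then the right-hand side of this inequality tends to $\cos(\frac{\pi}{a})$ as $M\to\infty$.
   Context: $\Gamma$ is the Gamma function. A real $M\times N$ unit norm frame is a real $M\times N$ matrix of rank $M$ whose columns $f_1,\ldots,f_N$ have Euclidean norm $1$. Its worst-case coherence is $\mu_F:=\max_{i,j\in\{1,\ldots,N\},\,i\neq j}|\langle f_i,f_j\rangle|$. *)

(* Defs.v *)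
From mathcomp Require Import all_boot all_order all_algebra.
From mathcomp Require Import all_classical all_reals all_analysis.

Set Implicit Arguments.
Unset Strict Implicit.
Unset Printing Implicit Defensive.

Import Order.TTheory GRing.Theory Num.Theory.
Import numFieldNormedType.Exports.

Local Open Scope classical_set_scope.
Local Open Scope ring_scope.

(* Meaningful for [0 < x], where the integral converges. *)
Definition Gamma {R : realType} (x : R) : R :=
  Rintegral lebesgue_measure `]0, +oo[ (fun t : R => t `^ (x - 1) * expR (- t)).

Definition dotcV {R : realType} {M : nat} (u v : 'cV[R]_M) : R :=
  \sum_(k < M) u k 0 * v k 0.

(* Not [`|u|], which on matrices is the sup norm. *)
Definition euclid_norm {R : realType} {M : nat} (u : 'cV[R]_M) : R :=
  Num.sqrt (dotcV u u).

Definition unit_norm_frame {R : realType} {M N : nat} (F : 'M[R]_(M, N)) : Prop :=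
  \rank F = M /\ forall j : 'I_N, euclid_norm (col j F) = 1.

(* The default value 0 of the maximum is harmless: all terms are nonnegative,
   and there is at least one pair [i != j] as soon as [2 <= N], which holds for
   frames with [2 <= M] since the rank [M] is at most [N]. *)
Definition coherence {R : realType} {M N : nat} (F : 'M[R]_(M, N)) : R :=
  \big[Num.max/0]_(p : 'I_N * 'I_N | p.1 != p.2)
    `|dotcV (col p.1 F) (col p.2 F)|.

Definition coherence_bound (R : realType) (M N : nat) : R :=
  cos (pi * ((M%:R - 1) / (N%:R * pi `^ (1 / 2))
             * (Gamma ((M%:R - 1) / 2) / Gamma (M%:R / 2)))
            `^ (1 / (M%:R - 1))).

(* Main.v *)
(* The N lines spanned by the columns are pairwise at angle at least [th := acos mu], so
   the open double cones of half-angle [th / 2] around them are disjoint, and the total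
   volume they cut out of the unit ball is at most that of the ball. By rotation
   invariance each of them has volume
     2 kappa_k (k / (k + 1)) \int_0^(th/2) sin^(k-1),
   where k = M - 1 and kappa_n is the volume of the n-dimensional unit ball; Jordan's
   inequality sin x >= 2 x / pi then bounds th by the angle in the statement, once
   kappa_n Gamma(n/2 + 1) = pi^(n/2) is used to express kappa_M / kappa_(M-1) by Gamma.

   Volumes are iterated one-dimensional Lebesgue integrals. Rotation invariance is only
   needed for functions of the form phi(<v, s>, |s|^2); for these it follows by induction
   on the dimension from its planar case, and a planar rotation is a product of shears.

   For the limit, with rho_M := kappa_M / kappa_(M-1), the bounds rho_M <= 2 and
   rho_M rho_(M+1) = 2 pi / (M + 1) make M rho_M / pi grow at most linearly and stay away
   from 0, so that only N^(1 / (M - 1)) --> a matters. *)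

From HB Require Import structures.
Require Import Defs.
From mathcomp Require Import all_boot all_order all_algebra.
From mathcomp Require Import all_classical all_reals all_analysis.
From mathcomp Require Import measurable_realfun ring lra.

Import Order.TTheory GRing.Theory Num.Theory.
Import numFieldNormedType.Exports.

Local Open Scope classical_set_scope.
Local Open Scope ring_scope.

(** * Iterated Lebesgue integrals *)

Section IteratedIntegral.
Context {R : realType}.
Local Notation mu := (@lebesgue_measure R).
Local Notation RR := (measurableTypeR R).
Local Open Scope ereal_scope.

Definition point (n : nat) : measurableType _ := n.-tuple RR.

(** The head coordinate is integrated last, so that splitting a tuple by cons matches one step of an
    induction on the dimension. *)
Fixpoint iint (n : nat) : (point n -> \bar R) -> \bar R :=
  match n with
  | 0%N => fun F => F [tuple]
  | k.+1 => fun F => \int[mu]_t iint k (fun s => F [tuple of t :: s])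
  end.

Lemma iintS n (F : point n.+1 -> \bar R) :
  iint n.+1 F = \int[mu]_t iint n (fun s => F [tuple of t :: s]).
Proof. by []. Qed.

Lemma eq_iint n (F G : point n -> \bar R) : F =1 G -> iint n F = iint n G.
Proof. by move=> /funext ->. Qed.

Lemma iint_ge0 n (F : point n -> \bar R) :
  (forall s, 0 <= F s) -> 0 <= iint n F.
Proof.
elim: n F => [|n IH] F F0 /=; first exact: F0.
by apply: integral_ge0 => t _; apply: IH.
Qed.

(** The parameter space [T] is arbitrary because the induction moves the head coordinate into the
    parameters, passing from [T] to [T * R]. *)
Lemma measurable_fun_iint n d (T : measurableType d)
    (F : T * point n -> \bar R) :
  measurable_fun setT F -> (forall p, 0 <= F p) ->
  measurable_fun setT (fun x => iint n (fun s => F (x, s))).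
Proof.
elim: n d T F => [|n IH] d T F mF F0 /=.
  apply: (measurableT_comp (f := F) (g := fun x => (x, [tuple]))) => //.
pose G (p : T * measurableTypeR R) := iint n (fun s => F (p.1, [tuple of p.2 :: s])).
have mG : measurable_fun setT G.
  apply: (IH _ (T * measurableTypeR R)%type
    (fun q => F (q.1.1, [tuple of q.1.2 :: q.2]))) => //.
  apply: measurableT_comp => //; apply: measurable_fun_pair => /=.
    exact: measurableT_comp.
  apply: measurable_cons; first exact: measurableT_comp.
  exact: measurable_snd.
apply: (measurable_fun_fubini_tonelli_F (m2 := mu) G) => // p.
by apply: iint_ge0.
Qed.

Lemma measurable_iint_cons n (F : point n.+1 -> \bar R) :
  measurable_fun setT F -> (forall p, 0 <= F p) ->
  measurable_fun setT (fun t : R => iint n (fun s => F [tuple of t :: s])).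
Proof.
move=> mF F0.
apply: (measurable_fun_iint n _ (measurableTypeR R)
  (fun q => F [tuple of q.1 :: q.2])) => //.
apply: measurableT_comp => //.
by apply: measurable_cons.
Qed.

Lemma measurable_fun_tuple_cons n (F : point n.+1 -> \bar R) (t : R) :
  measurable_fun setT F -> measurable_fun setT (fun s : point n => F [tuple of t :: s]).
Proof.
move=> mF; apply: measurableT_comp => //.
by apply: measurable_cons => //; exact: measurable_cst.
Qed.

Lemma le_iint n (F G : point n -> \bar R) :
  measurable_fun setT F -> measurable_fun setT G ->
  (forall s, 0 <= F s) -> (forall s, F s <= G s) -> iint n F <= iint n G.
Proof.
elim: n F G => [|n IH] F G mF mG F0 FG /=; first exact: FG.
apply: ge0_le_integral => //.
- by move=> t _; apply: iint_ge0.
- exact: measurable_iint_cons.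
- apply: measurable_iint_cons => // s; exact: le_trans (FG s).
- by move=> t _; apply: IH => //; exact: measurable_fun_tuple_cons.
Qed.

Lemma iint_sum n (I : Type) (r : seq I) (F : I -> point n -> \bar R) :
  (forall i, measurable_fun setT (F i)) -> (forall i s, 0 <= F i s) ->
  iint n (fun s => \sum_(i <- r) F i s) = \sum_(i <- r) iint n (F i).
Proof.
elim: n F => [|n IH] F mF F0 //=.
under eq_integral do (rewrite IH; [|by move=> i; exact: measurable_fun_tuple_cons|by []]).
rewrite ge0_integral_sum// => i.
- exact: measurable_iint_cons.
- by move=> t _; apply: iint_ge0.
Qed.

Lemma iintZl n (k : \bar R) (F : point n -> \bar R) :
  0 <= k -> measurable_fun setT F -> (forall s, 0 <= F s) ->
  iint n (fun s => k * F s) = k * iint n F.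
Proof.
move=> k0; elim: n F => [|n IH] F mF F0 //=.
under eq_integral do (rewrite IH//; last exact: measurable_fun_tuple_cons).
rewrite ge0_integralZl//.
- exact: measurable_iint_cons.
- by move=> t _; apply: iint_ge0.
Qed.

(** By induction the extra variable passes the tail, and planar Tonelli exchanges it with the head.
    This serves the layer-cake formula for the Gaussian integral. *)
Lemma iint_tonelli n (F : point n -> RR -> \bar R) :
  measurable_fun setT (fun p : point n * RR => F p.1 p.2) ->
  (forall s u, 0 <= F s u) ->
  iint n (fun s => \int[mu]_u F s u) = \int[mu]_u iint n (F ^~ u).
Proof.
elim: n F => [|n IH] F mF F0 //=.
have mc : measurable_fun setT
    (fun q : RR * RR * point n => F [tuple of q.1.1 :: q.2] q.1.2).
  have := mF; set G := (fun p : point n.+1 * RR => _) => mG.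
  apply: (measurableT_comp (f := G)
     (g := fun q : RR * RR * point n => ([tuple of q.1.1 :: q.2], q.1.2))) => //.
  apply: measurable_fun_pair => /=.
    by apply: measurable_cons; [exact: measurableT_comp|exact: measurable_snd].
  exact: measurableT_comp.
have mt t : measurable_fun setT
    (fun q : point n * RR => F [tuple of t :: q.1] q.2).
  have := mc; set G := (fun q : RR * RR * point n => _) => mG.
  apply: (measurableT_comp (f := G)
     (g := fun q : point n * RR => ((t, q.2), q.1))) => //.
  apply: measurable_fun_pair => //.
  by apply: measurable_fun_pair => //; exact: measurable_cst.
transitivity (\int[mu]_t \int[mu]_u iint n (fun s => F [tuple of t :: s] u)).
  apply: eq_integral => t _.
  exact: (IH (fun s u => F [tuple of t :: s] u) (mt t)).
rewrite (fubini_tonelli (m1 := mu) (m2 := mu)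
  (fun p : RR * RR => iint n (fun s => F [tuple of p.1 :: s] p.2)))//.
- exact: (measurable_fun_iint n _ (RR * RR)%type
    (fun q => F [tuple of q.1.1 :: q.2] q.1.2)).
- by move=> p; exact: iint_ge0.
Qed.

End IteratedIntegral.

(** * Invariance of planar Lebesgue measure *)

Section PlaneInvariance.
Context {R : realType}.
Local Notation mu := (@lebesgue_measure R).
Local Notation RR := (measurableTypeR R).
Local Open Scope ereal_scope.

(** The pushed-forward and rescaled measure [nu] agrees with Lebesgue measure on half-open
    intervals, hence everywhere by uniqueness. *)
Lemma lebesgue_measure_affine (a b : R) (A : set RR) : (0 < a)%R -> measurable A ->
  mu A = a%:E * mu [set t | A (a * t + b)%R].
Proof.
move=> a0 mA.
pose phi (t : RR) : RR := (a * t + b)%R.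
have mphi : measurable_fun setT phi.
  by apply: measurable_funD => //; apply: measurable_funM.
pose nu : {measure set RR -> \bar R} := mscale (NngNum (ltW a0))
  (measure_function_pushforward__canonical__measure_function_Measure mu mphi).
rewrite (@lebesgue_measure_unique R nu)// => _ [[x y]] _ <-.
have -> : nu `]x, y]%classic =
    a%:E * mu `]((x - b) / a)%R, ((y - b) / a)%R]%classic.
  congr (_ * mu _).
  apply/seteqP; split => t /=; rewrite !in_itv/= /phi => /andP[h1 h2];
    apply/andP; split.
  - by rewrite ltr_pdivrMr// ltrBlDr mulrC.
  - by rewrite ler_pdivlMr// lerBrDr mulrC.
  - by move: h1; rewrite ltr_pdivrMr// ltrBlDr mulrC.
  - by move: h2; rewrite ler_pdivlMr// lerBrDr mulrC.
rewrite !lebesgue_measure_itv/= !lte_fin ltr_pM2r ?invr_gt0// ltrD2r.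
case: ifPn => xy; last by rewrite mule0.
rewrite -!EFinB -EFinM; congr (_%:E).
by rewrite mulrBr !(mulrC a) !divfK ?gt_eqF//; lra.
Qed.

Lemma ge0_integral_affine (a b : R) (f : RR -> \bar R) : (0 < a)%R ->
  measurable_fun setT f -> (forall t, 0 <= f t) ->
  \int[mu]_t f t = a%:E * \int[mu]_t f (a * t + b)%R.
Proof.
move=> a0 mf f0.
pose phi (t : RR) : RR := (a * t + b)%R.
have mphi : measurable_fun setT phi.
  by apply: measurable_funD => //; apply: measurable_funM.
pose nu : {measure set RR -> \bar R} := mscale (NngNum (ltW a0))
  (measure_function_pushforward__canonical__measure_function_Measure mu mphi).
rewrite (@eq_measure_integral _ _ _ _ nu); last first.
  by move=> A mA _; exact: (@lebesgue_measure_affine a b A a0 mA).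
rewrite ge0_integral_mscale// ge0_integral_pushforward//=.
Qed.

Lemma ge0_integral_opp (f : RR -> \bar R) :
  measurable_fun setT f -> (forall t, 0 <= f t) ->
  \int[mu]_t f (- t)%R = \int[mu]_t f t.
Proof.
move=> mf f0.
have mphi : measurable_fun setT (-%R : RR -> RR) by exact: oppr_measurable.
have := ge0_integral_pushforward mphi mu measurableT mf (fun y _ => f0 y).
rewrite preimage_setT => <-; apply: eq_measure_integral => A mA _.
exact: lebesgue_measureN.
Qed.

(** Tonelli makes [t] the inner variable; for fixed [u] the shear is then a translation. *)
Lemma ge0_integral_shear1 (a : R) (h : RR * RR -> \bar R) :
  measurable_fun setT h -> (forall p, 0 <= h p) ->
  \int[mu]_t \int[mu]_u h (t + a * u, u)%R = \int[mu]_t \int[mu]_u h (t, u).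
Proof.
move=> mh h0.
have mg : measurable_fun setT (fun p : RR * RR => h (p.1 + a * p.2, p.2)%R).
  apply: measurableT_comp => //; apply: measurable_fun_pair => //.
  by apply: measurable_funD => //; apply: measurable_funM.
apply: (etrans (fubini_tonelli (m1 := mu) (m2 := mu) _ mg (fun p => h0 _))).
apply/esym/(etrans (fubini_tonelli (m1 := mu) (m2 := mu) h mh h0))/esym.
apply: eq_integral => u _ /=.
have mhu : measurable_fun setT (fun t : RR => h (t, u)).
  by apply: measurableT_comp => //; apply: measurable_fun_pair.
have /= := @ge0_integral_affine 1%R (a * u)%R _ ltr01 mhu (fun t => h0 (t, u)).
by rewrite mul1e => ->; apply: eq_integral => t _; rewrite mul1r.
Qed.

Lemma ge0_integral_shear2 (a : R) (h : RR * RR -> \bar R) :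
  measurable_fun setT h -> (forall p, 0 <= h p) ->
  \int[mu]_t \int[mu]_u h (t, u + a * t)%R = \int[mu]_t \int[mu]_u h (t, u).
Proof.
move=> mh h0; apply: eq_integral => t _.
have mhu : measurable_fun setT (fun u : RR => h (t, u)).
  by apply: measurableT_comp => //; apply: measurable_fun_pair.
have /= := @ge0_integral_affine 1%R (a * t)%R _ ltr01 mhu (fun u => h0 (t, u)).
by rewrite mul1e => ->; apply: eq_integral => u _; rewrite mul1r.
Qed.

(* A rotation by an angle that is not a multiple of pi is a product of three shears. *)
Lemma ge0_integral_rotation (c s : R) (h : RR * RR -> \bar R) :
  (c ^+ 2 + s ^+ 2 = 1)%R -> s != 0%R ->
  measurable_fun setT h -> (forall p, 0 <= h p) ->
  \int[mu]_t \int[mu]_u h (c * t + s * u, c * u - s * t)%R =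
  \int[mu]_t \int[mu]_u h (t, u).
Proof.
(* For [c = cos w] and [s = sin w], this [a] is tan(w / 2): the rotation is the shear by [a], then
   by [- s] in the other direction, then by [a] again. *)
move=> cs s0 mh h0; pose a := ((1 - c) / s)%R.
pose h1 (p : RR * RR) := h (p.1 + a * p.2, p.2)%R.
pose h2 (p : RR * RR) := h1 (p.1, p.2 + - s * p.1)%R.
have mh1 : measurable_fun setT h1.
  apply: measurableT_comp => //; apply: measurable_fun_pair => //.
  by apply: measurable_funD => //; apply: measurable_funM.
have mh2 : measurable_fun setT h2.
  apply: measurableT_comp => //; apply: measurable_fun_pair => //.
  by apply: measurable_funD => //; apply: measurable_funM.
have E1 := ge0_integral_shear1 a h mh h0.
have E2 := ge0_integral_shear2 (- s) h1 mh1 (fun p => h0 _).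
have E3 := ge0_integral_shear1 a h2 mh2 (fun p => h0 _).
apply: etrans (etrans E3 (etrans E2 E1)).
apply: eq_integral => t _; apply: eq_integral => u _; congr (h (_, _)).
- have sa : (s * a = 1 - c)%R by rewrite /a mulrC divfK.
  rewrite /=.
  have -> : (t + a * u + a * (u + - s * (t + a * u)) =
    t * (1 - s * a) + u * (a + a * (1 - s * a)))%R by ring.
  rewrite sa; have -> : (a + a * (1 - (1 - c)) = s)%R; last by ring.
  have -> : (a + a * (1 - (1 - c)) = (1 + c) * a)%R by ring.
  apply: (mulfI s0); rewrite mulrCA sa -expr2.
  have -> : (s ^+ 2 = 1 - c ^+ 2)%R by lra.
  by ring.
- have sa : (s * a = 1 - c)%R by rewrite /a mulrC divfK.
  rewrite /=.
  have -> : (u + - s * (t + a * u) = u * (1 - s * a) - s * t)%R by ring.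
  by rewrite sa; ring.
Qed.

End PlaneInvariance.

(** * Zonal functions *)

Section Zonal.
Context {R : realType}.
Local Notation mu := (@lebesgue_measure R).
Local Notation RR := (measurableTypeR R).

Definition tdot {n} (v s : n.-tuple R) : R := \sum_(i < n) tnth v i * tnth s i.

Lemma tdot_cons n (a b : R) (v s : n.-tuple R) :
  tdot [tuple of a :: v] [tuple of b :: s] = a * b + tdot v s.
Proof.
rewrite /tdot big_ord_recl !tnth0; congr (_ + _).
by apply: eq_bigr => i _; rewrite !tnthS.
Qed.

Lemma tdot0 (v s : 0.-tuple R) : tdot v s = 0.
Proof. by rewrite /tdot big_ord0. Qed.

Lemma tdot_ge0 n (s : n.-tuple R) : 0 <= tdot s s.
Proof. by apply: sumr_ge0 => i _; rewrite -expr2 sqr_ge0. Qed.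

Lemma measurable_tdot n (v : n.-tuple R) :
  measurable_fun setT (fun s : @point R n => tdot v s : RR).
Proof.
apply: measurable_sum => i; apply: measurable_funM => //.
exact: (@measurable_tnth _ RR).
Qed.

Lemma measurable_tnorm2 n :
  measurable_fun setT (fun s : @point R n => tdot s s : RR).
Proof.
apply: measurable_sum => i; apply: measurable_funM;
exact: (@measurable_tnth _ RR).
Qed.

Local Open Scope ereal_scope.

Definition radial n (phi : RR * RR -> \bar R) (p : RR * RR) : \bar R :=
  iint n (fun s => phi (p.1, p.2 + tdot s s)%R).

Lemma radial0 phi p : radial 0 phi p = phi p.
Proof. by case: p => a b; rewrite /radial /= tdot0 addr0. Qed.

Lemma radialS n phi p :
  radial n.+1 phi p = \int[mu]_t radial n phi (p.1, p.2 + t ^+ 2)%R.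
Proof.
rewrite /radial /=; apply: eq_integral => t _; apply: eq_iint => s.
by rewrite tdot_cons addrA expr2.
Qed.

Lemma radial_ge0 n phi p : (forall q, 0 <= phi q) -> 0 <= radial n phi p.
Proof. by move=> phi0; exact: iint_ge0. Qed.

Lemma measurable_radial n phi : measurable_fun setT phi ->
  (forall q, 0 <= phi q) -> measurable_fun setT (radial n phi).
Proof.
move=> mphi phi0.
apply: (measurable_fun_iint n _ (RR * RR)%type
  (fun q => phi (q.1.1, q.1.2 + tdot q.2 q.2)%R)) => //.
apply: measurableT_comp => //; apply: measurable_fun_pair.
  exact: measurableT_comp.
apply: measurable_funD; first exact: measurableT_comp.
exact: (measurableT_comp (measurable_tnorm2 n) measurable_snd).
Qed.

(** Rotation invariance: only the length of [v] matters. By induction the tail of [v] may be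
    replaced by its length [b] along a single coordinate [u]; a rotation of the [(t, u)] plane then
    carries the axis [(a, b)] to [(r, 0)]. *)
Lemma iint_zonal n (v : n.+1.-tuple R) (phi : RR * RR -> \bar R) :
  measurable_fun setT phi -> (forall q, 0 <= phi q) ->
  iint n.+1 (fun s => phi (tdot v s, tdot s s)) =
  \int[mu]_t radial n phi (Num.sqrt (tdot v v) * t, t ^+ 2)%R.
Proof.
elim: n v phi => [|n IH] v phi mphi phi0.
  rewrite /=; case/tupleP: v => a v.
  transitivity (\int[mu]_t phi (a * t, t ^+ 2)%R).
    by apply: eq_integral => t _; rewrite !tdot_cons !tdot0 !addr0 expr2.
  under [RHS]eq_integral do rewrite radial0 tdot_cons tdot0 addr0 -expr2 sqrtr_sqr.
  (* In dimension one the norm of [v] is [|a|], and a negative [a] is repaired by the reflection of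
     the line. *)
  have [a0|a0] := leP 0%R a; first by rewrite ger0_norm.
  rewrite ltr0_norm// -[RHS]ge0_integral_opp//.
    by apply: eq_integral => t _; rewrite mulrNN sqrrN.
  apply: measurableT_comp => //; apply: measurable_fun_pair.
    exact: measurable_funM.
  exact: measurable_funX.
case/tupleP: v => a v.
(* For a fixed head [t] the integrand is again zonal in the tail, with both arguments shifted by the
   contribution of [t]. *)
pose phit t (p : RR * RR) := phi (a * t + p.1, t ^+ 2 + p.2)%R.
have mphit t : measurable_fun setT (phit t).
  by apply: measurableT_comp => //; apply: measurable_fun_pair;
    exact: measurable_funD.
transitivity (\int[mu]_t
    iint n.+1 (fun s => phit t (tdot v s, tdot s s))).
  rewrite iintS; apply: eq_integral => t _; apply: eq_iint => s.
  by rewrite !tdot_cons /phit expr2.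
set b := Num.sqrt (tdot v v).
transitivity (\int[mu]_t \int[mu]_u radial n (phit t) (b * u, u ^+ 2)%R).
  by apply: eq_integral => t _; exact: (IH v (phit t) (mphit t) (fun q => phi0 _)).
pose G := radial n phi.
have mG : measurable_fun setT G by exact: measurable_radial.
have G0 p : 0 <= G p by exact: radial_ge0.
transitivity (\int[mu]_t \int[mu]_u G (a * t + b * u, t ^+ 2 + u ^+ 2)%R).
  apply: eq_integral => t _; apply: eq_integral => u _.
  by apply: eq_iint => s /=; rewrite /phit/= addrA.
under [RHS]eq_integral do rewrite radialS /=.
have -> : tdot [tuple of a :: v] [tuple of a :: v] = (a ^+ 2 + b ^+ 2)%R.
  by rewrite tdot_cons sqr_sqrtr ?tdot_ge0// expr2.
have b0 : (0 <= b)%R by exact: sqrtr_ge0.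
set r := Num.sqrt _.
pose h (p : RR * RR) := G (r * p.1, p.1 ^+ 2 + p.2 ^+ 2)%R.
have mh : measurable_fun setT h.
  apply: measurableT_comp => //; apply: measurable_fun_pair.
    by apply: measurable_funM.
  by apply: measurable_funD; apply: measurable_funX.
have r2 : (r ^+ 2 = a ^+ 2 + b ^+ 2)%R.
  by rewrite sqr_sqrtr// addr_ge0// sqr_ge0.
have r_ge0 : (0 <= r)%R by exact: sqrtr_ge0.
(* The rotation has cosine [a / r] and sine [b / r]; the product of shears requires a nonzero sine,
   so [b = 0] is treated apart. *)
have [b_eq0|b_neq0] := eqVneq b 0%R; last first.
  have r_neq0 : r != 0%R.
    apply/eqP => r_eq0; have := r2; rewrite r_eq0 expr0n/= => /esym/eqP.
    by rewrite paddr_eq0 ?sqr_ge0// !sqrf_eq0 (negbTE b_neq0) andbF.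
  have sr_neq0 : (b / r)%R != 0%R by rewrite mulf_neq0// invr_neq0.
  have cs : ((a / r) ^+ 2 + (b / r) ^+ 2 = 1)%R.
    by rewrite !expr_div_n -mulrDl -r2 divff// sqrf_eq0.
  apply: etrans (ge0_integral_rotation _ _ h cs sr_neq0 mh (fun p => G0 _)).
  apply: eq_integral => t _; apply: eq_integral => u _.
  rewrite /h /=; congr (G (_, _)).
    by field.
  transitivity (((a / r) ^+ 2 + (b / r) ^+ 2) * (t ^+ 2 + u ^+ 2))%R.
    by rewrite cs mul1r.
  by ring.
(* With [b = 0] the axis is already the first coordinate axis, up to a reflection when [a] is
   negative. *)
have r_abs : (r = `|a|)%R by rewrite /r b_eq0 expr0n addr0 sqrtr_sqr.
transitivity (\int[mu]_t \int[mu]_u G (a * t, t ^+ 2 + u ^+ 2)%R).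
  by apply: eq_integral => t _; apply: eq_integral => u _;
    rewrite b_eq0 mul0r addr0.
have [a0|a0] := leP 0%R a; first by rewrite r_abs ger0_norm.
have mH : measurable_fun setT (fun t : RR => \int[mu]_u h (t, u)).
  exact: (measurable_fun_fubini_tonelli_F (m2 := mu) h mh (fun p => G0 _)).
apply/esym/(etrans (esym (ge0_integral_opp _ mH _))).
  by move=> t; apply: integral_ge0 => u _; exact: G0.
apply: eq_integral => t _; apply: eq_integral => u _.
by rewrite /h/= r_abs ltr0_norm// mulrNN sqrrN.
Qed.

End Zonal.

(** * Volumes of balls *)

Section BallVolume.
Context {R : realType}.
Local Notation mu := (@lebesgue_measure R).
Local Notation RR := (measurableTypeR R).
Local Open Scope ereal_scope.

(** The parameter is the squared radius, so that slicing at height [t] just subtracts [t ^+ 2]; the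
    strict inequality makes the ball empty for [b <= 0], also when [n = 0]. *)
Definition eball n (b : R) : \bar R :=
  iint n (fun s => if (tdot s s < b)%R then 1 else 0).

Lemma iint0 n : iint n (fun _ : @point R n => 0) = 0.
Proof.
by elim: n => [//|n IH]; rewrite iintS IH integral0.
Qed.

Lemma measurable_ltr_indic d (T : measurableType d) (f g : T -> RR) :
  measurable_fun setT f -> measurable_fun setT g ->
  measurable_fun setT (fun x => if (f x < g x)%R then 1 else 0 : \bar R).
Proof.
move=> mf mg; by apply: measurable_fun_ifT => //; exact: measurable_fun_ltr.
Qed.

Lemma indic_ge0 (c : bool) : 0 <= (if c then 1 else 0 : \bar R).
Proof. by case: c. Qed.

Lemma measurable_eball n : measurable_fun setT (eball n : RR -> \bar R).
Proof.
apply: (measurable_fun_iint n _ RR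
  (fun q => if (tdot q.2 q.2 < q.1)%R then 1 else 0)) => [|q]; last exact: indic_ge0.
apply: measurable_ltr_indic => //.
exact: (measurableT_comp (measurable_tnorm2 n) measurable_snd).
Qed.

Lemma eball_ge0 n b : 0 <= eball n b.
Proof. by apply: iint_ge0 => s; exact: indic_ge0. Qed.

Lemma eballS n b : eball n.+1 b = \int[mu]_t eball n (b - t ^+ 2)%R.
Proof.
rewrite /eball iintS; apply: eq_integral => t _; apply: eq_iint => s.
by rewrite tdot_cons ltrBrDl -expr2.
Qed.

Lemma eball_le0 n b : (b <= 0)%R -> eball n b = 0.
Proof.
move=> b0; rewrite -[RHS](iint0 n); apply: eq_iint => s.
by rewrite ltNge (le_trans b0)// tdot_ge0.
Qed.

(** Substituting [r * t] for the slicing variable contributes one factor [r] per dimension. *)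
Lemma eball_scale n (r b : R) : (0 < r)%R ->
  eball n (r ^+ 2 * b)%R = (r ^+ n)%:E * eball n b.
Proof.
move=> r0; elim: n b => [|n IH] b.
  by rewrite expr0 mul1e /eball /= tdot0 pmulr_rgt0// exprn_gt0.
have m1 (c : R) : measurable_fun setT (fun t : RR => eball n (c - t ^+ 2)%R).
  apply: measurableT_comp; first exact: measurable_eball.
  by apply: measurable_funB => //; apply: measurable_funX.
rewrite !eballS (@ge0_integral_affine _ r 0%R _ r0 (m1 _))//; last first.
  by move=> t; exact: eball_ge0.
transitivity (r%:E * \int[mu]_t ((r ^+ n)%:E * eball n (b - t ^+ 2)%R)).
  congr (_ * _); apply: eq_integral => t _.
  by rewrite -IH addr0 exprMn -mulrBr.
rewrite ge0_integralZl//; last 2 first.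
- by move=> t _; exact: eball_ge0.
- by rewrite lee_fin exprn_ge0// ltW.
by rewrite muleA -EFinM -exprS.
Qed.

Lemma eballE n (b : R) : (0 < b)%R ->
  eball n b = (Num.sqrt b ^+ n)%:E * eball n 1%R.
Proof.
by move=> b0; rewrite -eball_scale ?sqrtr_gt0// sqr_sqrtr ?ltW// mulr1.
Qed.

Lemma iint_gauss n :
  iint n (fun s : @point R n => (expR (- tdot s s))%:E) = (Num.sqrt pi ^+ n)%:E.
Proof.
elim: n => [|n IH]; first by rewrite /= tdot0 oppr0 expR0 expr0.
rewrite iintS.
transitivity (\int[mu]_t ((gauss_fun t)%:E * (Num.sqrt pi ^+ n)%:E)).
  apply: eq_integral => t _; rewrite -IH -iintZl.
  - by apply: eq_iint => s; rewrite -EFinM -expRD tdot_cons -expr2 opprD.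
  - by rewrite lee_fin gauss_fun_ge0.
  - apply/measurable_EFinP; apply: measurableT_comp => //.
    apply: measurableT_comp => //; exact: measurable_tnorm2.
  - by move=> s; rewrite lee_fin expR_ge0.
rewrite ge0_integralZr//.
- by rewrite integralT_gauss -EFinM -exprS.
- by apply/measurable_EFinP; exact: measurable_gauss_fun.
- by move=> t _; rewrite lee_fin gauss_fun_ge0.
Qed.

(** Writes [expR (- x)] as an integral over the levels above [x], the ingredient common to the
    layer-cake formula and the functional equation of [Gamma]. *)
Lemma integral_expRN (x : R) :
  \int[mu]_u (if (x < u)%R then (expR (- u))%:E else 0) = (expR (- x))%:E.
Proof.
transitivity (\int[mu]_(u in `]x, +oo[) (expR (- u))%:E).
  rewrite [RHS]integral_mkcond; apply: eq_integral => u _.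
  by rewrite patchE mem_setE in_itv/= andbT.
have cexpN : continuous (fun u : R => expR (- u)).
  by move=> u; apply: continuous_comp; [exact: opp_continuous|exact: continuous_expR].
rewrite integral_itv_obnd_cbnd; last first.
  by apply/measurable_EFinP; apply: measurable_funTS; exact: continuous_measurable_fun.
have d (u : R) : is_derive u 1%R (fun v : R => - expR (- v))%R (expR (- u)).
  by apply: is_derive_eq; rewrite ?scaleN1r ?mulN1r ?mulrN1 ?scalerN1 ?opprK.
rewrite (@ge0_continuous_FTC2y R _ (fun u => - expR (- u))%R x 0%R)//.
- by rewrite EFinN oppeK add0e.
- exact: continuous_subspaceT.
- rewrite -[X in _ --> X]oppr0; apply: cvgN; exact: cvgr_expR.
- apply: cvg_at_right_filter; apply: cvgN; exact: cexpN.
- by move=> u _; rewrite derive1E derive_val.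
Qed.

(** Layer cake: the points whose squared norm lies below the level [u] form the ball of squared
    radius [u]. *)
Lemma iint_gauss_eball n :
  iint n (fun s : @point R n => (expR (- tdot s s))%:E) =
  \int[mu]_u ((expR (- u))%:E * eball n u).
Proof.
pose F (s : @point R n) (u : RR) : \bar R :=
  if (tdot s s < u)%R then (expR (- u))%:E else 0.
transitivity (iint n (fun s : @point R n => \int[mu]_u F s u)).
  by apply: eq_iint => s; rewrite -integral_expRN.
rewrite iint_tonelli.
- apply: eq_integral => u _; rewrite -iintZl.
  + by apply: eq_iint => s; rewrite /F; case: ifP; rewrite (mule1, mule0).
  + by rewrite lee_fin expR_ge0.
  + by apply: measurable_ltr_indic => //; exact: measurable_tnorm2.
  + by move=> s; exact: indic_ge0.
- apply: measurable_fun_ifT => //.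
    apply: measurable_fun_ltr => //.
    exact: (measurableT_comp (measurable_tnorm2 n) measurable_fst).
  apply/measurable_EFinP; apply: measurableT_comp => //.
  exact: measurableT_comp.
- by move=> s u; rewrite /F; case: ifP => // _; rewrite lee_fin expR_ge0.
Qed.

Lemma integral_expRN_eball n :
  \int[mu]_u ((expR (- u))%:E * eball n u) =
  eball n 1%R * \int[mu]_(u in `]0%R, +oo[) (u `^ (n%:R / 2) * expR (- u))%:E.
Proof.
rewrite -ge0_integralZl//; last 3 first.
- apply/measurable_EFinP; apply: measurable_funM.
    by apply: measurable_funTS; exact: measurable_powR.
  by apply: measurable_funTS; do 2 apply: measurableT_comp => //.
- by move=> u _; rewrite lee_fin mulr_ge0 ?powR_ge0 ?expR_ge0.
- exact: eball_ge0.
rewrite [RHS]integral_mkcond; apply: eq_integral => u _.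
rewrite patchE mem_setE in_itv/= andbT; case: ltP => u0; last first.
  by rewrite eball_le0// mule0.
rewrite (eballE n u u0) muleA muleC -EFinM; congr (_ * _%:E).
rewrite mulrC; congr (_ * _)%R.
by rewrite -powR12_sqrt ?ltW// -powR_mulrn ?powR_ge0// -powRrM mulrC (mulrC n%:R).
Qed.

End BallVolume.

Definition kappa {R : realType} n : R := fine (eball n (1 : R)).

(** * The volume of the unit ball expressed through Gamma *)

Section Kappa.
Context {R : realType}.
Local Notation mu := (@lebesgue_measure R).

Let eball_Gamma n :
  (eball n (1 : R) * \int[mu]_(u in `]0%R, +oo[) (u `^ (n%:R / 2) * expR (- u))%:E
   = (Num.sqrt pi ^+ n)%:E)%E.
Proof. by rewrite -integral_expRN_eball -iint_gauss_eball iint_gauss. Qed.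

(** A product of two nonnegative extended reals that is finite and positive has no factor equal to 0
    or [+oo]; so the Gaussian identity yields both finiteness and positivity. *)
Let kappa_fin n : exists2 k : R, 0 < k & eball n (1 : R) = k%:E.
Proof.
have := eball_Gamma n; have := eball_ge0 n (1 : R).
set I := (\int[_]_(_ in _) _)%E.
have I0 : (0 <= I)%E.
  by apply: integral_ge0 => u _; rewrite lee_fin mulr_ge0 ?powR_ge0 ?expR_ge0.
have p0 : 0 < Num.sqrt pi ^+ n :> R by rewrite exprn_gt0// sqrtr_gt0 pi_gt0.
case: (eball n 1) => [k||]//.
  rewrite lee_fin le_eqVlt => /predU1P[<-|k0 _]; last by exists k.
  by rewrite mul0e => /esym [] /eqP; rewrite gt_eqF.
move=> _; case: I I0 => [i||]// i0.
  move: i0; rewrite lee_fin le_eqVlt => /predU1P[<-|i0].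
    by rewrite mule0 => -[] /esym/eqP; rewrite gt_eqF.
  by rewrite gt0_mulye.
Qed.

Lemma eball1E n : eball n (1 : R) = (kappa n)%:E.
Proof. by rewrite /kappa; have [k _ ->] := kappa_fin n. Qed.

Lemma kappa_gt0 n : 0 < kappa n :> R.
Proof. by rewrite /kappa; have [k k0 ->] := kappa_fin n. Qed.

(** Since [Rintegral] would send a divergent integral to 0, finiteness has to be established first;
    it follows from [eball_Gamma] and [kappa_gt0]. *)
Lemma kappa_Gamma n : kappa n * Gamma (n%:R / 2 + 1) = Num.sqrt pi ^+ n :> R.
Proof.
have := eball_Gamma n; rewrite eball1E /Gamma /Rintegral addrK.
set I := (\int[_]_(_ in _) _)%E.
have I0 : (0 <= I)%E.
  by apply: integral_ge0 => u _; rewrite lee_fin mulr_ge0 ?powR_ge0 ?expR_ge0.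
case: I I0 => [i||]// _; first by rewrite -EFinM => -[].
by rewrite gt0_muley// lte_fin kappa_gt0.
Qed.

(** The unit ball lies in the cylinder of height 2 over the unit ball of one dimension less. *)
Lemma kappaS_le n : kappa n.+1 <= 2 * kappa n :> R.
Proof.
have mb : measurable_fun setT (fun t : measurableTypeR R => eball n (1 - t ^+ 2)%R).
  apply: measurableT_comp; first exact: measurable_eball.
  by apply: measurable_funB => //; apply: measurable_funX.
rewrite -lee_fin -eball1E eballS EFinM.
apply: (@le_trans _ _ (\int[mu]_t
  ((kappa n)%:E * (\1_(`[(-1)%R, 1%R] : set (measurableTypeR R)) t)%:E)))%E.
  apply: ge0_le_integral => //.
  - by move=> t _; exact: eball_ge0.
  - apply/measurable_EFinP; apply: measurable_funM => //; exact: measurable_indic.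
  - move=> t _; rewrite indicE mem_setE in_itv/=.
    have [h|h] := leP (1 - t ^+ 2) 0.
      by rewrite eball_le0// mule_ge0// lee_fin// ltW// kappa_gt0.
    have t1 : `|t| <= 1 by rewrite -(@expr_le1 _ 2)// real_normK ?num_real//; lra.
    move: t1; rewrite ler_norml => ->; rewrite mule1 (eballE n _ h) eball1E -EFinM lee_fin.
    apply: ler_piMl; first exact/ltW/kappa_gt0.
    apply: exprn_ile1; first exact: sqrtr_ge0.
    rewrite -[leRHS]sqrtr1; apply: ler_wsqrtr.
    by rewrite lerBlDr lerDl sqr_ge0.
rewrite ge0_integralZl//; last 2 first.
- by apply/measurable_EFinP; exact: measurable_indic.
- by rewrite lee_fin ltW// kappa_gt0.
rewrite integral_indic// setIT muleC.
apply: lee_wpmul2r; first by rewrite lee_fin ltW// kappa_gt0.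
have := lebesgue_measure_itv (`[(-1), 1] : interval R); rewrite /= lte_fin.
rewrite ifT; last by lra.
by move=> ->; rewrite -EFinB lee_fin; lra.
Qed.

End Kappa.

(** * The functional equation of Gamma *)

Section GammaFunctionalEquation.
Context {R : realType}.
Local Notation mu := (@lebesgue_measure R).
Local Notation RR := (measurableTypeR R).
Local Open Scope ereal_scope.

Lemma integral_powR_bnd (x e t : R) : (0 < e)%R -> (e < t)%R ->
  \int[mu]_(s in `[e, t]) (x * s `^ (x - 1))%:E = (t `^ x - e `^ x)%:E.
Proof.
move=> e0 et; have c (s y : R) : (0 < s)%R -> {for s, continuous (@powR R ^~ y)}.
  move=> s0; apply/differentiable_continuous/derivable1_diffP.
  by apply: derivable_powR; rewrite in_itv/= andbT.
rewrite (@continuous_FTC2 R _ (@powR R ^~ x) e t et) ?EFinB//.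
- apply: continuous_in_subspaceT => s; rewrite inE/= in_itv/= => /andP[es _].
  have s0 := lt_le_trans e0 es.
  by apply: (@cvgM R R^o); [exact: cvg_cst|exact: c].
- split.
  + move=> s; rewrite in_itv/= => /andP[es _].
    by apply: derivable_powR; rewrite in_itv/= andbT (lt_trans e0).
  + by apply: cvg_at_right_filter; exact: c.
  + by apply: cvg_at_left_filter; apply: c; exact: lt_trans et.
- move=> s; rewrite in_itv/= => /andP[es _]; rewrite powR_derive1//.
  by rewrite in_itv/= andbT (lt_trans e0).
Qed.

Lemma integral_powR0 (x t : R) : (0 < x)%R -> (0 < t)%R ->
  \int[mu]_(s in `]0%R, t]) (x * s `^ (x - 1))%:E = (t `^ x)%:E.
Proof.
(* The intervals [[e n, t]] exhaust []0, t]], and monotone convergence applies; the shift [n.+2]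
   gives [e n < t] from [n = 0] on. *)
move=> x0 t0; pose e n : R := (t / n.+2%:R)%R.
have e_gt0 n : (0 < e n)%R by rewrite divr_gt0.
have e_lt n : (e n < t)%R by rewrite gtr_pMr// invf_lt1// ltr1n.
have E : \bigcup_n `[e n, t]%classic = `]0%R, t]%classic.
  apply/seteqP; split => [s [n _]|s] /=; rewrite !in_itv/= => /andP[s0 st].
    by rewrite st (lt_le_trans _ s0).
  exists (Num.truncn (t / s)) => //=; rewrite in_itv/= st andbT.
  rewrite ler_pdivrMr// mulrC -ler_pdivrMr// ltW//.
  by rewrite (lt_trans (truncnS_gt _))// ltr_nat.
have nd : nondecreasing_seq (fun n => `[e n, t]%classic).
  move=> m n mn; apply/subsetPset => s /=; rewrite !in_itv/= => /andP[s0 st].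
  rewrite st andbT (le_trans _ s0)// ler_pM2l// lef_pV2 ?posrE// ler_nat.
  by rewrite !ltnS.
have mf : measurable_fun setT (fun s : RR => (x * s `^ (x - 1))%:E).
  by apply/measurable_EFinP; apply: measurable_funM => //; exact: measurable_powR.
have H := @ge0_nondecreasing_set_cvg_integral _ RR R (fun n => `[e n, t]%classic)
  (fun s => (x * s `^ (x - 1))%:E) mu nd (fun n => measurable_itv _).
rewrite E in H; apply: cvg_unique (H _ _) _ => //.
- by move=> n; exact: measurable_funTS.
- by move=> n s _; rewrite lee_fin mulr_ge0 ?powR_ge0// ltW.
rewrite /= (_ : (fun i => _) = fun n => (t `^ x - e n `^ x)%:E); last first.
  by apply/funext => n; exact: integral_powR_bnd.
apply: cvg_EFin; first exact: nearW.
rewrite -[X in _ --> X]subr0; apply: cvgB; first exact: cvg_cst.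
have e_cvg : (e n @[n --> \oo] --> 0^'+)%R.
  move=> A [d /= d0 Ad]; exists (Num.truncn (t / d)) => //= n tn; apply: Ad => //=.
  rewrite sub0r normrN gtr0_norm// ltr_pdivrMr// mulrC -ltr_pdivrMr//.
  by rewrite (lt_trans (truncnS_gt _))// ltr_nat ltnS.
exact: (cvg_comp _ _ e_cvg (powR_cvg0 x0)).
Qed.

(** Tonelli in place of integration by parts: [t]^ x[is the integral of]x * s [^ (x - 1)] over
    [0 < s <= t], and integrating [expR (- t)] over [t > s] gives back [expR (- s)]. *)
Lemma GammaS (x : R) : (0 < x)%R -> Gamma (x + 1)%R = (x * Gamma x)%R.
Proof.
move=> x0; rewrite /Gamma addrK.
have Z1 : \int[mu]_(s in `]0%R, +oo[)
      (x%:E * (s `^ (x - 1) * expR (- s))%:E) =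
    x%:E * \int[mu]_(s in `]0%R, +oo[) (s `^ (x - 1) * expR (- s))%:E.
  apply: ge0_integralZl => //.
  - by apply/measurable_EFinP; apply: measurable_funTS; apply: measurable_funM;
      [exact: measurable_powR|do 2 apply: measurableT_comp => //].
  - by move=> s _; rewrite lee_fin mulr_ge0 ?powR_ge0 ?expR_ge0.
  - by rewrite lee_fin ltW.
have Z2 (s c : R) : (0 <= c)%R ->
    \int[mu]_t (c%:E * (if (s < t)%R then (expR (- t))%:E else 0)) =
    (c * expR (- s))%:E.
  move=> c0; rewrite EFinM -integral_expRN; apply: ge0_integralZl => //.
  - apply: measurable_fun_ifT => //; first exact: measurable_fun_ltr.
    by apply/measurable_EFinP; do 2 apply: measurableT_comp => //.
  - by move=> t _; case: ifP => // _; rewrite lee_fin expR_ge0.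
pose f (t s : RR) : \bar R := if (0 < s)%R then if (s < t)%R then
  (x * s `^ (x - 1) * expR (- t))%:E else 0 else 0.
have mf : measurable_fun setT (fun p : RR * RR => f p.1 p.2).
  apply: measurable_fun_ifT.
  - by apply: measurable_fun_ltr => //; exact: measurable_cst.
  - apply: measurable_fun_ifT => //.
      by apply: measurable_fun_ltr => //; exact: measurable_snd.
    apply/measurable_EFinP; apply: measurable_funM.
      apply: measurable_funM => //.
      by apply: (measurableT_comp (measurable_powR _)).
    by do 2 apply: measurableT_comp => //.
  - exact: measurable_cst.
have f0 t s : 0 <= f t s.
  rewrite /f; case: ifP => // _; case: ifP => // _.
  by rewrite lee_fin !mulr_ge0 ?powR_ge0 ?expR_ge0// ltW.
have E1 : \int[mu]_(t in `]0%R, +oo[) (t `^ x * expR (- t))%:E =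
    \int[mu]_t \int[mu]_s f t s.
  rewrite integral_mkcond; apply: eq_integral => t _.
  rewrite patchE mem_setE in_itv/= andbT; case: ltP => t0; last first.
    rewrite integral0_eq// => s _; rewrite /f; case: ltP => // s0.
    by rewrite ltNge (le_trans t0 (ltW s0)).
  rewrite EFinM -(integral_powR0 x t x0 t0) -integral_itv_bndo_bndc; last first.
    by apply/measurable_EFinP; apply: measurable_funTS;
      apply: measurable_funM => //; exact: measurable_powR.
  rewrite -ge0_integralZr//; last 2 first.
  - by apply/measurable_EFinP; apply: measurable_funTS;
      apply: measurable_funM => //; exact: measurable_powR.
  - by move=> s _; rewrite lee_fin mulr_ge0 ?powR_ge0// ltW.
  rewrite integral_mkcond; apply: eq_integral => s _.
  by rewrite patchE mem_setE in_itv/= /f; case: ltP => //= _; case: ltP.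
have E2 : \int[mu]_s \int[mu]_t f t s =
    x%:E * \int[mu]_(s in `]0%R, +oo[) (s `^ (x - 1) * expR (- s))%:E.
  rewrite -Z1 [RHS]integral_mkcond; apply: eq_integral => s _.
  rewrite patchE mem_setE in_itv/= andbT; case: ltP => s0; last first.
    by rewrite integral0_eq// => t _; rewrite /f ltNge s0.
  rewrite -EFinM mulrA -Z2; last by rewrite mulr_ge0 ?powR_ge0// ltW.
  apply: eq_integral => t _; rewrite /f s0.
  by case: ltP => _; rewrite ?mule0// EFinM.
have E3 := fubini_tonelli (m1 := mu) (m2 := mu) (fun p => f p.1 p.2) mf
  (fun p => f0 _ _).
rewrite /Rintegral E1 {}E3 E2.
have : 0 <= \int[mu]_(s in `]0%R, +oo[) (s `^ (x - 1) * expR (- s))%:E.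
  by apply: integral_ge0 => s _; rewrite lee_fin mulr_ge0 ?powR_ge0 ?expR_ge0.
(* If the integral is [+oo], so is its multiple by [x], and both sides take the default value 0. *)
by case: (integral _ _ _) => [r||]//= _; rewrite gt0_muley ?mulr0.
Qed.

End GammaFunctionalEquation.

(** * Packing of double cones *)

Section Packing.
Context {R : realType}.
Local Notation mu := (@lebesgue_measure R).
Local Notation RR := (measurableTypeR R).

(** The sum of the squares [(B * u i - A * v i) ^+ 2] equals [A * (A * C - B ^+ 2)]; when [A = 0]
    all [u i] vanish. *)
Lemma sum_CauchySchwarz n (u v : 'I_n -> R) :
  (\sum_i u i * v i) ^+ 2 <= (\sum_i u i ^+ 2) * (\sum_i v i ^+ 2).
Proof.
set A := \sum_i u i ^+ 2; set B := \sum_i u i * v i; set C := \sum_i v i ^+ 2.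
have A0 : 0 <= A by apply: sumr_ge0 => i _; exact: sqr_ge0.
have : 0 <= \sum_i (B * u i - A * v i) ^+ 2.
  by apply: sumr_ge0 => i _; exact: sqr_ge0.
have expand p q : \sum_i (p * u i - q * v i) ^+ 2 =
    p ^+ 2 * A - 2 * p * q * B + q ^+ 2 * C.
  rewrite /A /B /C !mulr_sumr -sumrB -big_split /=.
  by apply: eq_bigr => i _; ring.
have -> : \sum_i (B * u i - A * v i) ^+ 2 = A * (A * C - B ^+ 2).
  by rewrite expand; ring.
move: A0; rewrite le_eqVlt => /predU1P[A0 _|A0]; last by rewrite pmulr_rge0// subr_ge0.
have u0 i : u i = 0.
  apply/eqP; rewrite -sqrf_eq0; move/esym/eqP: A0.
  by rewrite psumr_eq0 => [/allP/(_ i)|? _]; [rewrite mem_index_enum => /(_ isT)|exact: sqr_ge0].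
by rewrite -A0 mul0r /B big1 ?expr0n// => i _; rewrite u0 mul0r.
Qed.

(* [c] is the cosine of the half-angle of the two double cones, so [2 c^2 - 1] is the
   cosine of the smallest possible angle between their axes. *)
Lemma double_cones_disjoint n (u v x : n.-tuple R) (c : R) :
  tdot u u = 1 -> tdot v v = 1 ->
  `|tdot u v| <= 2 * c ^+ 2 - 1 ->
  c ^+ 2 * tdot x x < tdot u x ^+ 2 ->
  c ^+ 2 * tdot x x < tdot v x ^+ 2 -> False.
Proof.
move=> u1 v1; set g := tdot u v; set m := tdot x x.
set a := tdot u x; set b := tdot v x => gc ca cb.
have m0 : 0 <= m by exact: tdot_ge0.
(* For [y = tdot w x] this is [m] times the component of [w] orthogonal to [x]. Cauchy-Schwarz for
   the components of [u] and [v] is a form of the triangle inequality for angles. *)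
pose p (w : n.-tuple R) y i := m * tnth w i - y * tnth x i.
have pE (w w' : n.-tuple R) y y' : \sum_i p w y i * p w' y' i =
    m ^+ 2 * tdot w w' - m * y' * tdot w x - m * y * tdot w' x + y * y' * tdot x x.
  rewrite /tdot !mulr_sumr -!sumrB -big_split /=.
  by apply: eq_bigr => i _; rewrite /p; ring.
have := sum_CauchySchwarz n (p u a) (p v b).
under [X in _ <= X * _]eq_bigr do rewrite expr2.
under [X in _ <= _ * X]eq_bigr do rewrite expr2.
rewrite !pE u1 v1 -/a -/b -/g -/m.
have am : a ^+ 2 <= m.
  have := sum_CauchySchwarz n (tnth u) (tnth x).
  under [X in _ <= X * _]eq_bigr do rewrite expr2.
  under [X in _ <= _ * X]eq_bigr do rewrite expr2.
  by rewrite -!/(tdot _ _) u1 mul1r.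
have bm : b ^+ 2 <= m.
  have := sum_CauchySchwarz n (tnth v) (tnth x).
  under [X in _ <= X * _]eq_bigr do rewrite expr2.
  under [X in _ <= _ * X]eq_bigr do rewrite expr2.
  by rewrite -!/(tdot _ _) v1 mul1r.
have m_gt0 : 0 < m.
  rewrite lt_def m0 andbT; apply/eqP => m_eq0; move: ca am.
  by rewrite m_eq0 mulr0 => /lt_le_trans/[apply]; rewrite ltxx.
have -> : (m ^+ 2 * g - m * b * a - m * a * b + a * b * m) ^+ 2 =
    m ^+ 2 * (m * g - a * b) ^+ 2 by ring.
have -> : (m ^+ 2 * 1 - m * a * a - m * a * a + a * a * m) *
    (m ^+ 2 * 1 - m * b * b - m * b * b + b * b * m) =
    m ^+ 2 * ((m - a ^+ 2) * (m - b ^+ 2)) by ring.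
rewrite ler_pM2l ?exprn_gt0// => H.
(* The squared sine of the half-angle: membership in the cones makes both [m - a ^+ 2] and
   [m - b ^+ 2] at most [d * m]. *)
set d := 1 - c ^+ 2.
have d0 : 0 <= d * m by rewrite /d; lra.
have H1 : `|m * g - a * b| <= d * m.
  rewrite -(@ler_pXn2r _ 2)// ?nnegrE// real_normK ?num_real//.
  rewrite (le_trans H)// expr2; apply: ler_pM; rewrite ?subr_ge0//.
  - by rewrite /d; lra.
  - by rewrite /d; lra.
have H2 : c ^+ 2 * m < `|a * b|.
  rewrite -(@ltr_pXn2r _ 2)// ?nnegrE//; last by rewrite mulr_ge0// sqr_ge0.
  rewrite real_normK ?num_real// [ltRHS]exprMn [ltLHS]expr2.
  by apply: ltr_pM => //; rewrite mulr_ge0// ?sqr_ge0.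
have H3 : `|m * g| <= m * (2 * c ^+ 2 - 1).
  by rewrite normrM (ger0_norm m0) ler_wpM2l.
(* The right side is at most [m * (2 * c ^+ 2 - 1) + (1 - c ^+ 2) * m = c ^+ 2 * m], against
   [H2]. *)
have : `|a * b| <= `|m * g| + `|m * g - a * b|.
  by rewrite -{1}[a * b](subKr (m * g)) (le_trans (ler_normB _ _)).
by rewrite /d in H1; lra.
Qed.

Local Open Scope ereal_scope.

(** The argument stands for the pair (inner product with the axis, squared norm), the form required
    by [iint_zonal]; squaring [p.1] captures both nappes. *)
Definition double_cone (c : R) (p : RR * RR) : \bar R :=
  if (p.2 < 1)%R then if (c ^+ 2 * p.2 < p.1 ^+ 2)%R then 1 else 0 else 0.

Lemma double_cone_ge0 c p : 0 <= double_cone c p.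
Proof. by rewrite /double_cone; case: ifP => // _; case: ifP. Qed.

Lemma measurable_double_cone c : measurable_fun setT (double_cone c).
Proof.
apply: measurable_fun_ifT => //.
  by apply: measurable_fun_ltr => //; exact: measurable_cst.
apply: measurable_fun_ifT => //; apply: measurable_fun_ltr => //.
  exact: measurable_funM.
exact: measurable_funX.
Qed.

(** The slice at height [t] along the axis is a ball, bounded either by the unit sphere or by the
    cone; [c ^- 2 - 1] is the squared tangent of the half-angle. *)
Lemma radial_double_cone k (c t : R) : (0 < c)%R ->
  radial k (double_cone c) (t, t ^+ 2)%R =
  eball k (Num.min (1 - t ^+ 2) (t ^+ 2 * (c ^- 2 - 1)))%R.
Proof.
move=> c0; apply: eq_iint => s; rewrite /double_cone /= lt_min ltrBrDl.
case: ifP => //= _; congr (if _ then _ else _).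
rewrite -ltr_pdivlMl ?exprn_gt0// -ltrBrDl; congr (_ < _)%R.
by ring.
Qed.

Lemma double_cone_packing k N (f : 'I_N -> k.+1.-tuple R) (c : R) : (0 < c)%R ->
  (forall i, tdot (f i) (f i) = 1%R) ->
  (forall i j, i != j -> (`|tdot (f i) (f j)| <= 2 * c ^+ 2 - 1)%R) ->
  N%:R%:E * \int[mu]_t eball k (Num.min (1 - t ^+ 2) (t ^+ 2 * (c ^- 2 - 1)))%R
  <= (kappa k.+1)%:E.
Proof.
move=> c0 f1 fc; rewrite -eball1E.
set I := (\int[mu]_t _).
(* All cones have the same volume [I], since the axes are unit vectors. *)
have coneE i : iint k.+1 (fun s => double_cone c (tdot (f i) s, tdot s s)) = I.
  rewrite (iint_zonal k (f i) (double_cone c) (measurable_double_cone c) (double_cone_ge0 c)).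
  apply: eq_integral => t _.
  by rewrite f1 sqrtr1 mul1r radial_double_cone.
have mcone i : measurable_fun setT
    (fun s : @point R k.+1 => double_cone c (tdot (f i) s, tdot s s)).
  apply: measurableT_comp; first exact: measurable_double_cone.
  by apply: measurable_fun_pair; [exact: measurable_tdot|exact: measurable_tnorm2].
have -> : N%:R%:E * I = \sum_(i < N) I.
  by rewrite sumr_const card_ord mule_natl.
under eq_bigr => i _ do rewrite -(coneE i).
rewrite -iint_sum//; last by move=> i s; exact: double_cone_ge0.
apply: le_iint.
- by apply: emeasurable_sum => i; exact: mcone.
- by apply: measurable_ltr_indic => //; exact: measurable_tnorm2.
- by move=> s; apply: sume_ge0 => i _; exact: double_cone_ge0.
move=> s; rewrite /double_cone /=; case: ifP => s1; last by rewrite big1.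
(* At a point of the ball at most one of the summed indicators is 1, by disjointness. *)
have [i ui|noi] := pickP (fun i => (c ^+ 2 * tdot s s < tdot (f i) s ^+ 2)%R).
- rewrite (bigD1 i)//= ui big1 ?adde0// => j ji.
  case: ifP => // uj.
  by case: (double_cones_disjoint _ _ _ _ _ (f1 j) (f1 i) (fc _ _ ji) uj ui).
- by rewrite big1 // => i _; rewrite noi.
Qed.

End Packing.

(** * Volume of a double cone *)

Section CapIntegral.
Context {R : realType}.
Local Notation mu := (@lebesgue_measure R).
Local Notation RR := (measurableTypeR R).

(** If the graph were below the chord at [x], the mean value theorem would give a slope below
    [2 / pi] before [x] and one above it after [x], although [cos] decreases. *)
Lemma jordan_sin (x : R) : 0 <= x <= pi / 2 -> 2 / pi * x <= sin x.
Proof.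
move=> /andP[]; rewrite le_eqVlt => /predU1P[<- _|x0]; first by rewrite mulr0 sin0.
rewrite le_eqVlt => /predU1P[->|xpi].
  rewrite mulrA divfK ?gt_eqF ?pi_gt0// divff//.
  by rewrite sin_pihalf.
have p0 := pi_gt0 R.
rewrite leNgt; apply/negP => H.
have dsin (y : R) : is_derive y 1 sin (cos y) by exact: is_derive_sin.
have cs : {within `[0, x], continuous (@sin R)} by exact/continuous_subspaceT/continuous_sin.
have cs' : {within `[x, pi / 2], continuous (@sin R)} by exact/continuous_subspaceT/continuous_sin.
have [y1] := MVT x0 (fun y _ => dsin y) cs.
rewrite in_itv/= sin0 !subr0 => /andP[y10 y1x] E1.
have [y2] := MVT xpi (fun y _ => dsin y) cs'.
rewrite in_itv/= sin_pihalf => /andP[xy2 y2p] E2.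
have y2pi : y2 <= pi by rewrite (le_trans (ltW y2p))//; lra.
have C : cos y2 < cos y1.
  by rewrite ltr_cos ?in_itv/= ?(lt_trans y1x)//; apply/andP; split; lra.
have c1 : cos y1 < 2 / pi by rewrite -(ltr_pM2r x0) -E1.
have c2 : 2 / pi < cos y2.
  rewrite -(@ltr_pM2r _ (pi / 2 - x)) ?subr_gt0// -E2 mulrBr.
  by rewrite mulrA divfK ?gt_eqF// divff//; lra.
by have := lt_trans (lt_trans c1 c2) C; rewrite ltxx.
Qed.

(* Both sides vanish at [r = 0]; [H] integrates the derivative of their difference, which
   is nonnegative by Jordan's inequality. *)
Lemma sin_power_bound j (r : R) : 0 < r -> r <= pi / 2 ->
  (((2 / pi) ^+ j * r ^+ j.+1 / j.+2%:R)%:E <=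
  (sin r ^+ j.+1 * cos r / j.+2%:R)%:E +
  \int[mu]_(x in `[0%R, r]) (sin x ^+ j.+2)%:E)%E.
Proof.
move=> r0 rpi.
pose F (x : R) : R := (sin x ^+ j.+1 * cos x - (2 / pi) ^+ j * x ^+ j.+1) / j.+2%:R.
pose f (x : R) : R := (j.+1%:R * sin x ^+ j * cos x ^+ 2 - sin x ^+ j.+2
  - j.+1%:R * (2 / pi) ^+ j * x ^+ j) / j.+2%:R.
have dF (x : R) : is_derive x 1 F (f x).
  have -> : F = j.+2%:R^-1 \*: ((sin : R -> R) ^+ j.+1 * (cos : R -> R) -
      ((2 / pi) ^+ j) \*: (id : R -> R) ^+ j.+1).
    by apply/funext => y; rewrite /F !fctE /= mulrC.
  apply: is_derive_eq.
  rewrite !fctE /= /f /GRing.scale /= mulr1.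
  rewrite (_ : sin x ^+ j.+2 = sin x ^+ j.+1 * sin x); last by rewrite exprSr.
  by ring.
have cX (g : R -> R) n : continuous g -> continuous (fun x => g x ^+ n).
  by move=> cg x; apply: (@cvg_comp _ _ _ g (fun y => y ^+ n) _ _ _ (cg x));
    exact: exprn_continuous.
have cs n : continuous (fun x : R => sin x ^+ n) by exact/cX/continuous_sin.
have cf : continuous f.
  move=> x; apply: (@cvgM R R^o); last exact: cvg_cst.
  apply: cvgB; [apply: cvgB; [|exact: cs]|].
    apply: (@cvgM R R^o); last by apply: cX; exact: continuous_cos.
    by apply: (@cvgM R R^o); [exact: cvg_cst|exact: cs].
  apply: (@cvgM R R^o); first exact: cvg_cst.
  by apply: (cX id) => y; exact: cvg_id.
have FTC : (\int[mu]_(x in `[0%R, r]) (f x)%:E = (F r)%:E - (F 0)%:E)%E.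
  apply: continuous_FTC2 => //.
  - exact: continuous_subspaceT.
  - split.
    + by move=> x _; exact: ex_derive.
    + apply: cvg_at_right_filter; apply: differentiable_continuous.
      by apply/derivable1_diffP; exact: ex_derive.
    + apply: cvg_at_left_filter; apply: differentiable_continuous.
      by apply/derivable1_diffP; exact: ex_derive.
  - by move=> x _; rewrite derive1E derive_val.
have F0 : F 0 = 0 by rewrite /F sin0 !expr0n/= mul0r mulr0 subrr mul0r.
have H : (0 <= \int[mu]_(x in `[0%R, r]) (f x + sin x ^+ j.+2)%:E)%E.
  apply: integral_ge0 => x /=; rewrite in_itv/= => /andP[x0 xr]; rewrite lee_fin.
  have sx : 2 / pi * x <= sin x by rewrite jordan_sin// x0 (le_trans xr).
  (* Replacing [cos x ^+ 2] by [1 - sin x ^+ 2] makes all terms in [sin x ^+ j.+2] cancel. *)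
  have -> : f x + sin x ^+ j.+2 =
      j.+1%:R / j.+2%:R * (sin x ^+ j - (2 / pi * x) ^+ j).
    rewrite /f cos2sin2 (exprMn j (2 / pi) x).
    have -> : sin x ^+ j.+2 = sin x ^+ j * sin x ^+ 2 by rewrite -exprD addn2.
    have n0 : j.+2%:R != 0 :> R by rewrite pnatr_eq0.
    have -> : j.+1%:R = j.+2%:R - 1 :> R by rewrite -[j.+2]addn1 natrD addrK.
    by field.
  rewrite mulr_ge0// subr_ge0 lerXn2r ?nnegrE//.
    by rewrite mulr_ge0// divr_ge0// pi_ge0.
  by rewrite (le_trans _ sx)// mulr_ge0// divr_ge0// pi_ge0.
have i1 : mu.-integrable `[0%R, r] (EFin \o f).
  by apply: continuous_compact_integrable; [exact: segment_compact|exact: continuous_subspaceT].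
have i2 : mu.-integrable `[0%R, r] (EFin \o (fun x : R => sin x ^+ j.+2)).
  by apply: continuous_compact_integrable; [exact: segment_compact|exact: continuous_subspaceT].
move: H; under eq_integral do rewrite EFinD.
rewrite integralD//= FTC F0 sube0 => H.
have FrE : F r = sin r ^+ j.+1 * cos r / j.+2%:R
    - (2 / pi) ^+ j * r ^+ j.+1 / j.+2%:R by rewrite /F mulrBl.
have := leeD2l ((2 / pi) ^+ j * r ^+ j.+1 / j.+2%:R)%:E H.
by rewrite adde0 addeA -EFinD FrE (addrC _ (_ - _)) subrK.
Qed.

(** Substitution [t = cos x], whose Jacobian supplies the additional factor [sin x]. This is the
    part of the cone beyond its rim, where the sphere bounds the slices. *)
Lemma integral_sin_cap n (r : R) : 0 < r -> r <= pi / 2 ->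
  (\int[mu]_(t in `[cos r, 1%R]) (Num.sqrt (1 - t ^+ 2) ^+ n)%:E =
   \int[mu]_(x in `[0%R, r]) (sin x ^+ n.+1)%:E)%E.
Proof.
move=> r0 rpi; have p0 := pi_gt0 R.
have dc : (cos : R -> R)^`()%classic = (fun x : R => - sin x).
  by apply/funext => x; rewrite derive1E derive_val.
have cds : continuous (fun x : R => - sin x).
  by move=> x; apply: cvgN; exact: continuous_sin.
have := @integration_by_substitution_decreasing R cos
  (fun t => Num.sqrt (1 - t ^+ 2) ^+ n) 0 r (ltW r0).
rewrite cos0 dc => ->.
- apply: eq_integral => x; rewrite inE/= in_itv/= => /andP[x0 xr].
  rewrite !fctE/= opprK -sin2cos2 sqrtr_sqr ger0_norm ?exprSr//.
  by rewrite sin_ge0_pi// x0/=; lra.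
- move=> x y; rewrite !in_itv/= => /andP[x0 xr] /andP[y0 yr] xy.
  by rewrite ltr_cos// in_itv/=; apply/andP; split; lra.
- by move=> x _; exact: cds.
- by apply/cvg_ex; eexists; apply: cvg_at_right_filter; exact: cds.
- by apply/cvg_ex; eexists; apply: cvg_at_left_filter; exact: cds.
- split.
  + by move=> x _; exact: ex_derive.
  + by apply: cvg_at_right_filter; exact: continuous_cos.
  + by apply: cvg_at_left_filter; exact: continuous_cos.
- apply: continuous_subspaceT => x.
  apply: (@cvg_comp _ _ _ (fun t : R => Num.sqrt (1 - t ^+ 2)) (fun y => y ^+ n));
    last exact: exprn_continuous.
  apply: (@cvg_comp _ _ _ (fun t : R => 1 - t ^+ 2) Num.sqrt); last exact: sqrt_continuous.
  by apply: cvgB; [exact: cvg_cst|exact: exprn_continuous].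
Qed.

(** The part of the cone before its rim, where the slice at height [t] has radius [t * tan r]. *)
Lemma integral_sin_cone n (r : R) : 0 < r -> r < pi / 2 ->
  (\int[mu]_(t in `[0%R, cos r]) ((t * (sin r / cos r)) ^+ n)%:E =
   (sin r ^+ n * cos r / n.+1%:R)%:E)%E.
Proof.
move=> r0 rpi.
have c0 : 0 < cos r by rewrite cos_gt0_pihalf//; lra.
set q := sin r / cos r.
pose F (t : R) : R := q ^+ n / n.+1%:R * t ^+ n.+1.
have dF (t : R) : is_derive t 1 F ((t * q) ^+ n).
  have -> : F = (q ^+ n / n.+1%:R) \*: (id : R -> R) ^+ n.+1.
    by apply/funext => y; rewrite /F !fctE.
  apply: is_derive_eq; rewrite /GRing.scale /= mulr1 (exprMn n t q).
  by rewrite mulrA divfK ?pnatr_eq0// mulrC.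
have cF (t : R) : {for t, continuous F}.
  by apply: differentiable_continuous; apply/derivable1_diffP; exact: ex_derive.
rewrite (@continuous_FTC2 R _ F)//.
- rewrite /F expr0n/= mulr0 sube0 /q expr_div_n exprSr; congr (_%:E).
  rewrite mulrA [_ / _ * cos r ^+ n]mulrAC divfK 1?mulrAC//.
  by rewrite expf_neq0// gt_eqF.
- apply: continuous_subspaceT => t.
  apply: (@cvg_comp _ _ _ (fun t : R => t * q) (fun y => y ^+ n)); last exact: exprn_continuous.
  by apply: (@cvgM R R^o); [exact: cvg_id|exact: cvg_cst].
- split.
  + by move=> x _; exact: ex_derive.
  + by apply: cvg_at_right_filter; exact: cF.
  + by apply: cvg_at_left_filter; exact: cF.
- by move=> x _; rewrite derive1E derive_val.
Qed.

(** With [r] the half-angle, the slices change from cone to sphere at height [cos r]; adding the two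
    parts and doubling for the two nappes leaves exactly [sin_power_bound]. *)
Lemma double_cone_volume_ge j (r : R) : 0 < r -> r <= pi / 4 ->
  ((2 * kappa j.+1 * ((2 / pi) ^+ j * r ^+ j.+1 / j.+2%:R))%:E <=
  \int[mu]_t eball j.+1 (Num.min (1 - t ^+ 2) (t ^+ 2 * (cos r ^- 2 - 1)))%R)%E.
Proof.
move=> r0 rpi4; have p0 := pi_gt0 R.
have rpi : r < pi / 2 by lra.
set c := cos r.
have c0 : 0 < c by rewrite cos_gt0_pihalf//; lra.
have s0 : 0 < sin r by rewrite sin_gt0_pi//; lra.
have c1 : c < 1 by rewrite /c -cos0 ltr_cos ?in_itv/=; lra.
have cE : c ^- 2 - 1 = (sin r / c) ^+ 2.
  by rewrite expr_div_n sin2cos2 mulrBl mul1r divff// expf_neq0// gt_eqF.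
pose k := j.+1; pose g (t : RR) := eball k (Num.min (1 - t ^+ 2) (t ^+ 2 * (c ^- 2 - 1))).
have g0 t : (0 <= g t)%E by exact: eball_ge0.
have mg : measurable_fun setT g.
  apply: measurableT_comp; first exact: measurable_eball.
  apply: measurable_minr.
    by apply: measurable_funB => //; exact: measurable_funX.
  by apply: measurable_funM => //; exact: measurable_funX.
have k0 := kappa_gt0 (R := R) k.
have gcone (t : R) : t \in `]0, c] -> g t = ((kappa k)%:E * ((t * (sin r / c)) ^+ k)%:E)%E.
  rewrite in_itv/= => /andP[t0 tc]; rewrite /g cE -exprMn min_r.
    have q0 : 0 < (t * (sin r / c)) ^+ 2 by rewrite exprn_gt0// mulr_gt0// divr_gt0.
    rewrite (eballE _ _ q0) eball1E muleC.
    by rewrite sqrtr_sqr ger0_norm// mulr_ge0 ?divr_ge0// ltW.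
  rewrite exprMn -cE mulrBr mulr1 lerD2r ler_pdivrMr ?exprn_gt0// mul1r.
  by rewrite lerXn2r ?nnegrE// ltW.
have gcap (t : R) : t \in `]c, 1[ -> g t = ((kappa k)%:E * (Num.sqrt (1 - t ^+ 2) ^+ k)%:E)%E.
  rewrite in_itv/= => /andP[ct t1]; rewrite /g min_l.
    have t_gt0 : 0 < t by exact: lt_trans ct.
    have q0 : 0 < 1 - t ^+ 2 by rewrite subr_gt0 expr_lt1// ltW.
    by rewrite (eballE _ _ q0) eball1E muleC.
  rewrite mulrBr mulr1 lerD2r ler_pdivlMr ?exprn_gt0// mul1r.
  by rewrite lerXn2r ?nnegrE// ltW// (lt_trans c0).
pose P := `]0, +oo[%classic : set RR.
have mP : measurable P by exact: measurable_itv.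
pose h := (g \_ P)%E.
have h0 t : (0 <= h t)%E by rewrite /h patchE; case: ifP.
have mh : measurable_fun setT h.
  by apply/(measurable_restrictT _ _).1 => //; exact: measurable_funTS.
(* As [g] is even, [h t] and [h (- t)] have the same integral, and their sum never exceeds [g t]. *)
have I1 : (2%:E * \int[mu]_(t in P) g t <= \int[mu]_t g t)%E.
  rewrite mule_natl mule2n integral_mkcond -/h.
  have mho : measurable_fun setT (fun t : RR => h (- t)).
    by apply: measurableT_comp => //; exact: oppr_measurable.
  rewrite -{1}(ge0_integral_opp h mh h0) -ge0_integralD//.
  apply: ge0_le_integral => //.
  - by move=> t _; rewrite adde_ge0.
  - exact: emeasurable_funD.
  - move=> t _; rewrite /h !patchE !mem_setE !in_itv/= !andbT oppr_gt0.
    have [t0|t0|->] := ltgtP t 0; rewrite ?adde0 ?add0e//.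
    by rewrite /g sqrrN.
have I2 : (\int[mu]_(t in `]0%R, c]) g t + \int[mu]_(t in `]c, 1%R[) g t
    <= \int[mu]_(t in P) g t)%E.
  rewrite -ge0_integral_setU//=.
  - apply: ge0_subset_integral => //=.
    + exact: measurableU.
    + exact: measurable_funTS.
    + by move=> t [] /=; rewrite /P /= !in_itv/= => /andP[]; lra.
  - exact: measurable_funTS.
  - by apply/disj_setPS => t [] /=; rewrite !in_itv/= => /andP[_ tc] /andP[]; lra.
have J1 : (\int[mu]_(t in `]0%R, c]) g t =
    (kappa k)%:E * (sin r ^+ k * c / k.+1%:R)%:E)%E.
  rewrite -integral_sin_cone//.
  transitivity (\int[mu]_(t in `]0%R, c])
      ((kappa k)%:E * ((t * (sin r / c)) ^+ k)%:E))%E.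
    by apply: eq_integral => t; rewrite inE => tc; exact: gcone.
  rewrite ge0_integralZl//; last 3 first.
  - by apply/measurable_EFinP; apply: measurable_funTS; apply: measurable_funX;
      exact: measurable_funM.
  - move=> t /=; rewrite in_itv/= => /andP[t0 _].
    by rewrite lee_fin exprn_ge0// mulr_ge0 ?divr_ge0// ltW.
  - by rewrite lee_fin ltW.
  rewrite integral_itv_obnd_cbnd//.
  by apply/measurable_EFinP; apply: measurable_funTS; apply: measurable_funX;
      exact: measurable_funM.
have J2 : (\int[mu]_(t in `]c, 1%R[) g t =
    (kappa k)%:E * \int[mu]_(x in `[0%R, r]) (sin x ^+ k.+1)%:E)%E.
  have msq : measurable_fun setT (fun t : RR => Num.sqrt (1 - t ^+ 2) ^+ k).
    apply: measurable_funX; apply: measurableT_comp.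
      by apply: continuous_measurable_fun; exact: sqrt_continuous.
    by apply: measurable_funB => //; exact: measurable_funX.
  rewrite -integral_sin_cap//; last exact: ltW.
  transitivity (\int[mu]_(t in `]c, 1%R[)
      ((kappa k)%:E * (Num.sqrt (1 - t ^+ 2) ^+ k)%:E))%E.
    by apply: eq_integral => t; rewrite inE => tc; exact: gcap.
  rewrite ge0_integralZl//; last 2 first.
  - by apply/measurable_EFinP; exact: measurable_funTS.
  - by rewrite lee_fin ltW.
  rewrite integral_itv_obnd_cbnd; last first.
    by apply/measurable_EFinP; exact: measurable_funTS.
  rewrite integral_itv_bndo_bndc//.
  by apply/measurable_EFinP; exact: measurable_funTS.
apply: le_trans I1; rewrite -mulrA EFinM; apply: lee_wpmul2l => //.
apply: le_trans I2; rewrite J1 J2 -ge0_muleDr; last 2 first.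
- by rewrite lee_fin divr_ge0// mulr_ge0 ?exprn_ge0// ltW.
- apply: integral_ge0 => x /=; rewrite in_itv/= => /andP[x0 xr].
  by rewrite lee_fin exprn_ge0// sin_ge0_pi// x0/=; lra.
rewrite EFinM; apply: lee_wpmul2l; first by rewrite lee_fin ltW.
by apply: sin_power_bound => //; exact: ltW.
Qed.

End CapIntegral.

(** * The coherence bound *)

Section Bound.
Context {R : realType}.

(** Compare [kappa_Gamma] at [k] and [k.+2]: the two Gamma values differ by the factor
    [k%:R / 2 + 1], and the powers of [Num.sqrt pi] by [pi]. *)
Lemma kappaSS k : k.+2%:R * kappa k.+2 = 2 * pi * kappa k :> R.
Proof.
have h0 : 0 < k%:R / 2 + 1 :> R by rewrite ltr_wpDl// divr_ge0.
have := kappa_Gamma (R := R) k.+2.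
have -> : k.+2%:R / 2 + 1 = (k%:R / 2 + 1) + 1 :> R.
  by rewrite -addn2 natrD mulrDl divff.
have -> : Num.sqrt pi ^+ k.+2 = pi * Num.sqrt pi ^+ k :> R.
  by rewrite 2!exprS mulrA -expr2 sqr_sqrtr// pi_ge0.
rewrite (GammaS _ h0) -kappa_Gamma.
have G0 : Gamma (k%:R / 2 + 1) != 0 :> R.
  apply/eqP => G0; have := kappa_Gamma (R := R) k; rewrite G0 mulr0 => /esym/eqP.
  by rewrite expf_eq0 sqrtr_eq0 leNgt pi_gt0 andbF.
rewrite !mulrA => /(mulIf G0) E.
have -> : k.+2%:R = 2 * (k%:R / 2 + 1) :> R.
  by rewrite mulrDr mulr1 mulrCA divff// mulr1 -addn2 natrD.
by rewrite -2!mulrA -E; ring.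
Qed.

(** For [M = k.+1], both Gamma values are eliminated through [kappa_Gamma] and one use of the
    functional equation. *)
Lemma coherence_baseE k N : (0 < k)%N ->
  (k.+1%:R - 1) / (N%:R * pi `^ (1 / 2)) *
    (Gamma ((k.+1%:R - 1) / 2) / Gamma (k.+1%:R / 2)) =
  k.+1%:R * kappa k.+1 / (kappa k * pi) / N%:R :> R.
Proof.
move=> k0.
have kE : k.+1%:R - 1 = k%:R :> R by rewrite -addn1 natrD addrK.
rewrite kE div1r powR12_sqrt ?pi_ge0//.
have kR : 0 < k%:R :> R by rewrite ltr0n.
have s0 : 0 < Num.sqrt pi :> R by rewrite sqrtr_gt0 pi_gt0.
have GE n : (0 < n)%N ->
    Gamma (n%:R / 2) = Num.sqrt pi ^+ n * 2 / (n%:R * kappa n) :> R.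
  move=> n0; have nR : 0 < n%:R :> R by rewrite ltr0n.
  rewrite -kappa_Gamma GammaS ?divr_gt0//.
  have kn := kappa_gt0 (R := R) n.
  by field; rewrite !gt_eqF.
rewrite !GE//.
have k1 := kappa_gt0 (R := R) k; have k2 := kappa_gt0 (R := R) k.+1.
have kS : 0 < k.+1%:R :> R by rewrite ltr0n.
have piE : pi = Num.sqrt pi ^+ 2 :> R by rewrite sqr_sqrtr ?pi_ge0.
rewrite [pi in RHS]piE exprS.
(* For [N = 0] both sides are 0, as the inverse of 0 is 0. *)
have [->|N0] := eqVneq (N%:R : R) 0; first by rewrite mul0r invr0 !(mulr0, mul0r).
have sk0 : 0 < Num.sqrt pi ^+ k :> R by rewrite exprn_gt0.
by field; rewrite N0 !gt_eqF.
Qed.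

(** Combining [kappaSS] with [kappaS_le] at [k.+1] gives [pi * kappa k <= k.+2%:R * kappa k.+1], so
    the quotient is at least (k + 1) / (k + 2). *)
Lemma coherence_base_ge k : 2^-1 <= k.+1%:R * kappa k.+1 / (kappa k * pi) :> R.
Proof.
have k0 := kappa_gt0 (R := R) k; have p0 := pi_gt0 R.
rewrite ler_pdivlMr ?mulr_gt0//.
have := kappaSS k; have := kappaS_le (R := R) k.+1.
have k1 := kappa_gt0 (R := R) k.+1.
have : k.+2%:R = k.+1%:R + 1 :> R by rewrite -addn1 natrD.
have : 1 <= k.+1%:R :> R by rewrite ler1n.
nra.
Qed.

(** Because [kappa k.+1 <= 2 * kappa k] and [2 <= pi]. *)
Lemma coherence_base_le k : k.+1%:R * kappa k.+1 / (kappa k * pi) <= k.+1%:R :> R.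
Proof.
have k0 := kappa_gt0 (R := R) k; have p0 := pi_gt0 R; have p2 := pi_ge2 R.
rewrite ler_pdivrMr ?mulr_gt0// ler_wpM2l//.
have := kappaS_le (R := R) k.
nra.
Qed.

End Bound.

(** * The coherence of frames and the limit of the bound *)

Section CoherenceBound.
Context {R : realType}.

Local Notation base k := (k.+1%:R * kappa k.+1 / (kappa k * pi) : R).

Lemma coherence_boundE k N : (0 < k)%N ->
  coherence_bound R k.+1 N = cos (pi * (base k / N%:R) `^ k%:R^-1).
Proof.
move=> k0; rewrite /coherence_bound coherence_baseE// div1r.
by congr (cos (_ * _ `^ (_^-1))); rewrite -addn1 natrD addrK.
Qed.

Lemma dotcV_tdot M (u v : 'cV[R]_M) :
  dotcV u v = tdot [tuple u p 0 | p < M] [tuple v p 0 | p < M].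
Proof. by apply: eq_bigr => p _; rewrite !tnth_mktuple. Qed.

Lemma coherence_ge M N (F : 'M[R]_(M, N)) (i j : 'I_N) : i != j ->
  `|dotcV (col i F) (col j F)| <= coherence F.
Proof.
by move=> ij; rewrite /coherence (bigD1 (i, j))//= le_max lexx.
Qed.

Lemma coherence_ge0 M N (F : 'M[R]_(M, N)) : 0 <= coherence F.
Proof.
by rewrite /coherence; elim/big_ind: _ => // x y x0 _; rewrite le_max x0.
Qed.

Lemma coherence_bound_le M N (F : 'M[R]_(M, N)) :
  (2 <= M)%N -> unit_norm_frame F -> coherence_bound R M N <= coherence F.
Proof.
case: M F => [|[|j]] F // _ [rkF nF]; set k := j.+1.
rewrite coherence_boundE//.
(* Coherence at least 1 exceeds any cosine; below 1 the angle [th] is positive and the cones are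
   nondegenerate. *)
have [mu1|mu1] := leP 1 (coherence F); first exact: le_trans (cos_le1 _) mu1.
have p0 := pi_gt0 R.
have mu0 := coherence_ge0 _ _ F.
have mub : -1 <= coherence F <= 1 by apply/andP; split; lra.
set th := acos (coherence F).
have thE : cos th = coherence F by rewrite acosK// in_itv.
have th0 : 0 < th by rewrite acos_gt0//; lra.
have thpi : th <= pi / 2.
  rewrite leNgt; apply/negP => h.
  have : cos th < cos (pi / 2).
    by rewrite ltr_cos ?in_itv/= ?(acos_lepi mub) ?(ltW th0)//; lra.
  by rewrite thE cos_pihalf; lra.
have kN : (k.+1 <= N)%N by rewrite -[k.+1]rkF rank_leq_col.
have N0 : 0 < N%:R :> R by rewrite ltr0n (leq_trans _ kN).
have kN' : k.+1%:R <= N%:R :> R by rewrite ler_nat.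
have kk := kappa_gt0 (R := R) k; have kS := kappa_gt0 (R := R) k.+1.
have S0 : 0 < k.+1%:R :> R by rewrite ltr0n.
set x := base k / N%:R.
(* From [base k <= k.+1%:R] and [k.+1 <= N], the latter by the rank condition; this keeps the angle
   of the bound in [[0, pi]], where [cos] decreases. *)
have x_le1 : x <= 1.
  by rewrite ler_pdivrMr// mul1r (le_trans _ kN')// coherence_base_le.
have x_ge0 : 0 <= x by rewrite !mulr_ge0 ?invr_ge0 ?mulr_ge0// ltW.
have main : (th / pi) ^+ k <= x.
  pose f i : k.+1.-tuple R := [tuple col i F p 0 | p < k.+1].
  have c0 : 0 < cos (th / 2) by rewrite cos_gt0_pihalf//; lra.
  have f1 i : tdot (f i) (f i) = 1.
    rewrite -dotcV_tdot -[LHS]sqr_sqrtr; last by rewrite dotcV_tdot tdot_ge0.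
    by have := nF i; rewrite /euclid_norm => ->; rewrite expr1n.
  (* By the double-angle formula the right side is [cos th], the coherence. *)
  have fc i l : i != l -> `|tdot (f i) (f l)| <= 2 * cos (th / 2) ^+ 2 - 1.
    move=> il; rewrite -dotcV_tdot (le_trans (coherence_ge _ _ _ _ _ il))//.
    have half : (th / 2) *+ 2 = th by rewrite -mulr_natr divfK.
    by have := cos_mulr2n (th / 2); rewrite half thE mulr_natl => ->.
  have P := double_cone_packing k N f _ c0 f1 fc.
  have V := double_cone_volume_ge j (th / 2) _ _.
  have {}V := V ltac:(lra) ltac:(lra).
  have {V}P : N%:R * (2 * kappa k * ((2 / pi) ^+ j * (th / 2) ^+ k / k.+1%:R)) <=
      kappa k.+1.
    rewrite -lee_fin EFinM; apply: le_trans P.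
    by apply: lee_wpmul2l => //; rewrite lee_fin ltW.
  rewrite ler_pdivlMr// ler_pdivlMr ?mulr_gt0//.
  (* Since [th / pi = 2 / pi * (th / 2)], the power [(2 / pi) ^+ j] from Jordan's inequality lacks
     one factor, which [2 * kappa k] and the new [pi] supply. *)
  have -> : (th / pi) ^+ k * N%:R * (kappa k * pi) =
    k.+1%:R * (N%:R * (2 * kappa k * ((2 / pi) ^+ j * (th / 2) ^+ k / k.+1%:R))).
    have -> : th / pi = 2 / pi * (th / 2) by rewrite [RHS]mulrC mulrA divfK.
    rewrite exprMn [(2 / pi) ^+ k]exprS.
    move: ((2 / pi) ^+ j) ((th / 2) ^+ k) => A B.
    move: p0; generalize (pi : R) => q q0.
    by field; rewrite !gt_eqF.
  by rewrite ler_wpM2l// ltW.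
have kR : 0 < k%:R :> R by rewrite ltr0n.
have root_ge : th <= pi * x `^ k%:R^-1.
  rewrite mulrC -ler_pdivrMr//.
  have t0 : 0 <= th / pi by rewrite divr_ge0// ltW.
  have -> : th / pi = ((th / pi) ^+ k) `^ k%:R^-1.
    by rewrite -powR_mulrn// -powRrM divff ?gt_eqF// powRr1.
  by apply: ge0_ler_powR; rewrite ?nnegrE ?invr_ge0 ?exprn_ge0// ltW.
have root_le : pi * x `^ k%:R^-1 <= pi.
  apply: ler_piMr; first exact: ltW.
  apply: (@le_trans _ _ (1 `^ k%:R^-1)); last by rewrite powR1.
  by apply: ge0_ler_powR; rewrite ?nnegrE ?invr_ge0// ltW.
have root_ge0 : 0 <= pi * x `^ k%:R^-1 by rewrite mulr_ge0 ?powR_ge0// ltW.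
rewrite -thE; move: root_ge; rewrite le_eqVlt => /predU1P[->//|root_gt].
by rewrite ltW// ltr_cos ?in_itv/= ?root_ge0// (ltW th0)/=; lra.
Qed.

(** In logarithmic form the bound is [cos (pi * expR (l k))], so by continuity it suffices that
    [l k] tends to [- ln a]. *)
Lemma coherence_bound_cvg (a : R) (N : nat -> nat) : 0 < a ->
  (fun M : nat => (N M)%:R : R^o) \is 'Theta_\oo (fun M : nat => a ^+ M : R^o) ->
  coherence_bound R M (N M) @[M --> \oo] --> cos (pi / a).
Proof.
move=> a0; rewrite qualifE => /asboolP[[c1' c2']] /= /andP[c10 c20] [n0 _ bnd].
pose c1 : R := c1'; pose c2 : R := c2'.
rewrite -/c1 in c10 bnd; rewrite -/c2 in c20 bnd.
have {}bnd k : (n0 <= k)%N ->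
    c1 * a ^+ k.+1 <= (N k.+1)%:R /\ (N k.+1)%:R <= c2 * a ^+ k.+1.
  move=> nk; have := bnd k.+1 (leqW nk).
  by rewrite /= (ger0_norm (exprn_ge0 _ (ltW a0))) (ger0_norm (ler0n _ _)).
(* Passing to [M = k.+1] turns the root exponent into [k%:R^-1]. *)
rewrite -(cvg_shiftS (fun M => coherence_bound R M (N M))).
have piR := pi_gt0 R.
pose l k := ln (base k / (N k.+1)%:R) / k%:R.
have N_gt0 k : (n0 <= k)%N -> 0 < (N k.+1)%:R :> R.
  by move=> /bnd[h _]; apply: lt_le_trans h; rewrite mulr_gt0// exprn_gt0.
have b_gt0 k : 0 < base k.
  by rewrite (lt_le_trans _ (coherence_base_ge k))// invr_gt0.
suff H : l k @[k --> \oo] --> - ln a.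
  have E : {near \oo, (fun k => cos (pi * expR (l k))) =1
      (fun k => coherence_bound R k.+1 (N k.+1))}.
    exists n0.+1 => // k /= nk; have k0 : (0 < k)%N by exact: leq_trans nk.
    have NE := N_gt0 k (ltnW nk).
    have q0 : 0 < base k / (N k.+1)%:R by exact: divr_gt0 (b_gt0 k) NE.
    by rewrite coherence_boundE// /powR gt_eqF// /l (mulrC k%:R^-1).
  have G1 : expR (l k) @[k --> \oo] --> expR (- ln a).
    exact: (cvg_comp _ _ H (@continuous_expR R _)).
  have G2 : pi * expR (l k) @[k --> \oo] --> pi / a.
    have -> : pi / a = pi * expR (- ln a) by rewrite expRN lnK.
    by apply: cvgM; [exact: cvg_cst|exact: G1].
  have G3 := cvg_comp _ _ G2 (@continuous_cos R _).
  exact: (cvg_trans (near_eq_cvg E) G3).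
(* Collects what does not grow with [k]: the lower bound 1/2 on [base k], the Theta constants, and
   one [ln a] left over from [a ^+ k.+1] against [k]. *)
pose C : R := `|ln 2| + `|ln a| + `|ln c1| + `|ln c2|.
have l_dist k : (n0 < k)%N -> `|- ln a - l k| * k%:R <= ln k.+1%:R + C.
  move=> nk; have [N1 N2] := bnd k (ltnW nk); have N0 := N_gt0 k (ltnW nk).
  have k0 : 0 < k%:R :> R by rewrite ltr0n (leq_trans _ nk).
  have ak : 0 < a ^+ k.+1 by rewrite exprn_gt0.
  have L1 : ln c1 + k.+1%:R * ln a <= ln (N k.+1)%:R.
    by rewrite mulr_natl -lnXn// -lnM ?posrE// ler_ln ?posrE// mulr_gt0.
  have L2 : ln (N k.+1)%:R <= ln c2 + k.+1%:R * ln a.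
    by rewrite mulr_natl -lnXn// -lnM ?posrE// ler_ln ?posrE// mulr_gt0.
  have L3 : - ln 2 <= ln (base k).
    by rewrite -lnV ?posrE// ler_ln ?posrE ?invr_gt0// coherence_base_ge.
  have L4 : ln (base k) <= ln k.+1%:R.
    by rewrite ler_ln ?posrE ?ltr0n// coherence_base_le.
  have L5 : 0 <= ln k.+1%:R :> R by rewrite ln_ge0// ler1n.
  rewrite -[X in _ * X](ger0_norm (ltW k0)) -normrM mulrBl /l divfK ?gt_eqF//.
  rewrite ln_div ?posrE//.
  have kS : k.+1%:R = k%:R + 1 :> R by rewrite -addn1 natrD.
  rewrite kS in L1 L2.
  have := ler_norm (ln c2); have := ler_norm (- ln c1); have := ler_norm (ln 2 : R).
  have := ler_norm (ln a); have := ler_norm (- ln a); rewrite !normrN.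
  have := normr_ge0 (ln c1); have := normr_ge0 (ln c2); have := normr_ge0 (ln 2 : R).
  rewrite ler_norml /C => *; apply/andP; split; lra.
apply/cvgrPdist_le => e e0.
(* Since [ln y <= y] at [y = e / 2 * k.+1%:R], one has [ln k.+1%:R <= e / 2 * k.+1%:R - ln (e / 2)];
   the bound on [m] lets the other half of [e * k%:R] absorb the constants. *)
have [m mP] : exists m : nat, (e / 2 - ln (e / 2) + C) / (e / 2) <= m%:R.
  exists (Num.truncn ((e / 2 - ln (e / 2) + C) / (e / 2))).+1.
  exact/ltW/truncnS_gt.
exists (maxn n0.+1 m) => // k /=; rewrite geq_max => /andP[nk mk].
have k0 : 0 < k%:R :> R by rewrite ltr0n (leq_trans _ nk).
rewrite -(ler_pM2r k0) (le_trans (l_dist k nk))//.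
have kS : 0 < k.+1%:R :> R by rewrite ltr0n.
have e2 : 0 < e / 2 by rewrite divr_gt0.
have := ln_sublinear (mulr_gt0 e2 kS); rewrite lnM ?posrE//.
have mk' : e / 2 * m%:R <= e / 2 * k%:R by rewrite ler_wpM2l ?ler_nat// ltW.
have : k.+1%:R = k%:R + 1 :> R by rewrite -addn1 natrD.
have mP' : e / 2 - ln (e / 2) + C <= e / 2 * m%:R.
  by rewrite (mulrC (e / 2) m%:R) -ler_pdivrMr.
by move=> ->; lra.
Qed.

End CoherenceBound.

Theorem theorem7 (R : realType) :
  (forall (M N : nat) (F : 'M[R]_(M, N)),
      (2 <= M)%N -> unit_norm_frame F ->
      coherence_bound R M N <= coherence F) /\
  (forall (a : R) (N : nat -> nat),
      0 < a ->
      (fun M : nat => (N M)%:R : R^o) \is 'Theta_\oo (fun M : nat => a ^+ M : R^o) ->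
      coherence_bound R M (N M) @[M --> \oo] --> cos (pi / a)).
Proof.
split=> [M N F|a N]; first exact: coherence_bound_le.
exact: coherence_bound_cvg.
Qed.
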